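(* Let $n,m,r\in\mathbb Z_+$. For positive integers $N\ge mr$ let $\left\{{N\atop m}\right\}_{\ge r}$ denote the number of partitions of $\{1,\dots,N\}$ into $m$ sets, each of size at least $r$. If $n\ge mr+1$, then \[\left\{{n\atop m}\right\}_{\ge r}\ \le\ \frac{m^{mr+1}}{m!}\left\{{n-1\atop m}\right\}_{\ge r}.\]
   Context: The numbers $\left\{{N\atop m}\right\}_{\ge r}$ are the $r$-associated Stirling numbers (of the second kind). *)

(* Defs.v *)
From mathcomp Require Import all_boot all_order all_algebra.

Set Implicit Arguments.
Unset Strict Implicit.
Unset Printing Implicit Defensive.

(* The r-associated Stirling number of the second kind. The N-element ground
   set {1, ..., N} is represented by 'I_N = {0, ..., N - 1}. *)
Definition assoc_stirling2 (r N m : nat) : nat :=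
  #|[set P : {set {set 'I_N}} |
      [&& partition P [set: 'I_N],
          #|P| == m &
          [forall B : {set 'I_N} in P, r <= #|B|]]]|.

(* Main.v *)
Require Import Defs.
From mathcomp Require Import all_boot all_order all_algebra.

(** Call [P] admissible if it partitions the ground set into [m] blocks of
    size at least [r].  A partition of [n > m * r] elements into [m] blocks has
    a block with at least [n / m] elements, and this block is larger than [r].
    Hence at least [n / m] points of each admissible [P] can be deleted so that
    [P] stays admissible.  Conversely, a given point [x] is deletable in at most
    [m * S] admissible partitions, where [S] counts the admissible partitions of
    [n - 1] elements: such a [P] can be rebuilt from what remains after the
    deletion of [x] and from the one of the [m] blocks that [x] belonged to
    ([card_deletable]).

    Counting the pairs ([P], deletable point of [P]) in both ways bounds the
    number of admissible partitions of [n] elements by [m ^ 2 * S]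
    ([assoc_stirling2_leq_sqr]).  The constant in the theorem is at least
    [m ^ 2], because [m`! <= m ^ (m - 1)] and [r >= 1]. *)

Set Implicit Arguments.
Unset Strict Implicit.
Unset Printing Implicit Defensive.

Import Order.TTheory GRing.Theory Num.Theory.

Definition admissible (T : finType) (r m : nat) : {set {set {set T}}} :=
  [set P : {set {set T}} |
     [&& partition P [set: T], #|P| == m
       & [forall B : {set T} in P, r <= #|B|]]].

(** The trace of [B] on the points other than [x], transported to ['I_n] by
    closing the gap at [x], so that the result is again a set of ordinals. *)
Definition pull (n : nat) (x : 'I_n.+1) (B : {set 'I_n.+1}) : {set 'I_n} :=
  lift x @^-1: B.

Lemma admissibleP (T : finType) r m (P : {set {set T}}) :
  reflect [/\ partition P [set: T], #|P| = m & {in P, forall B : {set T}, r <= #|B|}]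
          (P \in admissible T r m).
Proof.
rewrite inE; apply: (iffP and3P) => [[pP /eqP cP /forall_inP hP]|[pP cP hP]];
  split=> //; [exact/eqP | exact/forall_inP].
Qed.

Lemma imset_pull n (x : 'I_n.+1) B : lift x @: pull x B = B :\ x.
Proof.
apply/setP=> y; rewrite !inE; apply/imsetP/andP => [[z]|[yx yB]].
  by rewrite inE => zB ->; rewrite eq_sym neq_lift.
have [z yz _] := unlift_some (i := y) (h := x) ltac:(by rewrite eq_sym).
by exists z => //; rewrite inE -yz.
Qed.

Lemma card_pull n (x : 'I_n.+1) B : #|pull x B| = #|B :\ x|.
Proof. by rewrite -imset_pull card_imset //; apply: lift_inj. Qed.

Section Preimage.

Variables (T T' : finType) (f : T' -> T) (P : {set {set T}}).
Hypothesis pP : partition P [set: T].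
Hypothesis nonempty : {in P, forall B : {set T}, f @^-1: B != set0}.

(** Disjoint blocks have disjoint preimages, so two blocks with the same nonempty
    preimage meet and hence coincide. *)
Lemma preimset_inj_partition : {in P &, injective (fun B : {set T} => f @^-1: B)}.
Proof.
move=> A B AP BP /= eqAB; have /and3P[_ tP _] := pP.
have /set0Pn[z zA] := nonempty AP.
have zB : z \in f @^-1: B by rewrite -eqAB.
rewrite !inE in zA zB.
by rewrite -(def_pblock tP AP zA) (def_pblock tP BP zB).
Qed.

Lemma preimset_partition : partition [set f @^-1: (B : {set T}) | B in P] [set: T'].
Proof.
have /and3P[/eqP cP tP _] := pP.
apply/and3P; split.
- apply/eqP/setP=> z; rewrite inE; apply/bigcupP.
  have zP : f z \in cover P by rewrite cP inE.
  by exists (f @^-1: pblock P (f z)); rewrite ?inE ?mem_pblock // imset_f // pblock_mem.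
- apply/trivIsetP=> _ _ /imsetP[A AP ->] /imsetP[B BP ->] neAB.
  have /(trivIsetP tP _ _ AP BP) dAB : A != B by apply: contraNneq neAB => ->.
  by rewrite -setI_eq0 -preimsetI; move: dAB; rewrite -setI_eq0 => /eqP->; rewrite preimset0.
- by apply/imsetP=> -[B BP] /esym/eqP; apply/negP/nonempty.
Qed.

End Preimage.

Section Deletion.

Variables (n m r : nat) (x : 'I_n.+1).
Hypothesis r_gt0 : 0 < r.

(** The partitions that remain admissible when the point [x] is removed from its
    block. *)
Definition deletable : {set {set {set 'I_n.+1}}} :=
  [set P in admissible 'I_n.+1 r m | r < #|pblock P x|].

Definition delete (P : {set {set 'I_n.+1}}) : {set {set 'I_n}} :=
  [set pull x B | B in P].

Lemma card_pull_deletable P :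
  P \in deletable -> {in P, forall B : {set 'I_n.+1}, r <= #|pull x B|}.
Proof.
rewrite inE => /andP[/admissibleP[pP _ hP] big] B BP.
have /and3P[_ tP _] := pP.
rewrite card_pull; case: (boolP (x \in B)) => xB.
  by move: big; rewrite (def_pblock tP BP xB) (cardsD1 x) xB.
by have := hP _ BP; rewrite (cardsD1 x B) (negPf xB).
Qed.

Lemma pull_deletable_neq0 P :
  P \in deletable -> {in P, forall B : {set 'I_n.+1}, pull x B != set0}.
Proof.
move=> dP B BP; rewrite -card_gt0.
exact: leq_trans r_gt0 (card_pull_deletable dP BP).
Qed.

Lemma delete_admissible P : P \in deletable -> delete P \in admissible 'I_n r m.
Proof.
move=> dP; have := dP; rewrite inE => /andP[/admissibleP[pP cP hP] big].
apply/admissibleP; split.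
- by apply: preimset_partition pP _; apply: pull_deletable_neq0.
- rewrite card_in_imset //; apply: preimset_inj_partition pP _.
  exact: pull_deletable_neq0.
- by move=> _ /imsetP[B BP ->]; apply: card_pull_deletable dP _ BP.
Qed.

(** The second component marks the block that lost [x], and putting [x] back into
    it recovers [P].  The mark is unambiguous because the blocks of [P] have
    distinct traces outside [x], all of them being nonempty. *)
Lemma delete_inj :
  {in deletable &, injective (fun P : {set {set 'I_n.+1}} => (delete P, pull x (pblock P x)))}.
Proof.
pose rebuild (c : {set {set 'I_n}} * {set 'I_n}) :=
  [set if B == c.2 then x |: lift x @: B else lift x @: B | B in c.1].
apply: (can_in_inj (g := rebuild)) => P dP.
have := dP; rewrite inE => /andP[/admissibleP[pP _ _] _].
have /and3P[/eqP cP tP _] := pP.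
have xP : x \in cover P by rewrite cP inE.
rewrite /rebuild /delete -imset_comp /= -[RHS]imset_id.
apply: eq_in_imset => B BP /=.
rewrite (inj_in_eq (preimset_inj_partition pP (pull_deletable_neq0 dP))) ?pblock_mem //.
rewrite imset_pull; case: eqVneq => [->|neB]; first by rewrite setD1K ?mem_pblock.
apply/setDidPl; rewrite disjoint_sym disjoints1.
by apply: contraNN neB => xB; rewrite (def_pblock tP BP xB).
Qed.

(** By [delete_inj] these partitions are no more numerous than the admissible
    partitions of the remaining points with one of their [m] blocks marked. *)
Lemma card_deletable : #|deletable| <= #|admissible 'I_n r m| * m.
Proof.
rewrite -(card_in_imset delete_inj).
pose pointed := [set c : {set {set 'I_n}} * {set 'I_n} |
                  (c.1 \in admissible 'I_n r m) && (c.2 \in c.1)].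
have <- : #|pointed| = #|admissible 'I_n r m| * m.
  rewrite -sum1_card (eq_bigl _ _ (in_set _)) -sum_nat_const.
  rewrite -(pair_big_dep (mem (admissible 'I_n r m)) (fun Q B => B \in Q) (fun _ _ => 1)).
  by apply: eq_bigr => Q /admissibleP[_ cQ _]; rewrite sum1_card.
apply: subset_leq_card; apply/subsetP=> _ /imsetP[P dP ->].
rewrite inE delete_admissible //= imset_f // pblock_mem //.
by move: dP; rewrite inE => /andP[/admissibleP[/and3P[/eqP-> _ _] _ _] _]; rewrite inE.
Qed.

End Deletion.

(** A largest block is at least as large as the average. *)
Lemma exists_large_block (T : finType) m (P : {set {set T}}) :
  partition P [set: T] -> #|P| = m -> 0 < m ->
  exists2 B, B \in P & #|T| <= m * #|B|.
Proof.
move=> pP cP; rewrite -cP => /card_gt0P[A0 A0P].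
case: (arg_maxnP (fun A : {set T} => #|A|) A0P) => B BP maxB.
exists B => //; rewrite -cardsT (card_partition pP) -sum_nat_const.
exact: leq_sum.
Qed.

(** A largest block has at least [n.+1 / m > r] points, and every point of a block
    larger than [r] is deletable. *)
Lemma card_deletable_points n m r (P : {set {set 'I_n.+1}}) :
  0 < m -> m * r < n.+1 -> P \in admissible 'I_n.+1 r m ->
  n.+1 <= m * #|[set x | P \in deletable m r x]|.
Proof.
move=> m_gt0 mr_lt aP; have /admissibleP[pP cP _] := aP.
have [B BP] := exists_large_block pP cP m_gt0; rewrite card_ord => nB.
have rB : r < #|B| by rewrite -(ltn_pmul2l m_gt0) (leq_trans mr_lt).
apply: leq_trans nB _; rewrite leq_pmul2l //.
apply/subset_leq_card/subsetP=> x xB; rewrite inE inE aP /=.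
by have /and3P[_ tP _] := pP; rewrite (def_pblock tP BP xB).
Qed.

(** The factor [m ^ 2] combines two losses of a factor [m]: a share of only [1 / m]
    of the points of a partition is known to be deletable, and the block that
    lost the point can be any of [m]. *)
Lemma assoc_stirling2_leq_sqr n m r : 0 < r -> 0 < m -> m * r < n.+1 ->
  assoc_stirling2 r n.+1 m <= m ^ 2 * assoc_stirling2 r n m.
Proof.
move=> r_gt0 m_gt0 mr_lt.
change (#|admissible 'I_n.+1 r m| <= m ^ 2 * #|admissible 'I_n r m|).
set S := #|admissible 'I_n r m|; rewrite -(leq_pmul2r (ltn0Sn n)).
(* The sum counts the pairs of a partition and one of its deletable points. *)
apply: (@leq_trans (m * \sum_(x < n.+1) #|deletable m r x|)); last first.
  have -> : m ^ 2 * S * n.+1 = m * (n.+1 * (S * m)).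
    by rewrite expnS expn1 -!mulnA (mulnC n.+1) -mulnA (mulnCA S).
  rewrite leq_pmul2l // -[n.+1 in leqRHS]card_ord -sum_nat_const.
  by apply: leq_sum => x _; apply: card_deletable.
rewrite -sum_nat_const.
apply: (@leq_trans (\sum_(P in admissible 'I_n.+1 r m)
                      m * #|[set x | P \in deletable m r x]|)).
  by apply: leq_sum => P; apply: card_deletable_points.
rewrite -big_distrr leq_pmul2l //=.
(* Both sides now sum 1 over the same pairs, in the two orders. *)
under eq_bigr do rewrite -sum1_card.
under [leqRHS]eq_bigr do rewrite -sum1_card.
rewrite [leqRHS](exchange_big_dep (mem (admissible 'I_n.+1 r m))) /=.
  apply: leq_sum => P aP.
  by rewrite leq_eqVlt; apply/orP; left; apply/eqP/eq_bigl => x; rewrite inE.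
by move=> x P _; rewrite inE => /andP[].
Qed.

Lemma fact_leq_exp k : k.+1`! <= k.+1 ^ k.
Proof.
elim: k => // k IHk; rewrite factS expnS leq_pmul2l //.
by apply: leq_trans IHk _; case: k => // k; rewrite leq_exp2r.
Qed.

Local Open Scope ring_scope.

Theorem lemma4p2 (n m r : nat) (hn : (0 < n)%N) (hm : (0 < m)%N)
    (hr : (0 < r)%N) (hnmr : (m * r + 1 <= n)%N) :
  ((assoc_stirling2 r n m)%:R : rat) <=
    m%:R ^+ (m * r + 1) / (m`!)%:R * (assoc_stirling2 r (n - 1) m)%:R.
Proof.
case: n hn hnmr => // n _; rewrite addn1 subn1 /= => mr_lt.
rewrite mulrAC ler_pdivlMr ?ltr0n ?fact_gt0 // -natrX -!natrM ler_nat.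
have le_const : (m ^ 2 * m`! <= m ^ (m * r).+1)%N.
  apply: (@leq_trans (m ^ m.+1)); last by rewrite leq_pexp2l // ltnS leq_pmulr.
  case: m hm {mr_lt} => // m _.
  by rewrite -(addn2 m) addnC expnD leq_pmul2l ?expn_gt0 // fact_leq_exp.
apply: leq_trans (leq_mul (assoc_stirling2_leq_sqr hr hm mr_lt) (leqnn _)) _.
by rewrite mulnAC leq_mul2r le_const orbT.
Qed.
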